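(* Let $n,m\ge 5$ be integers. Then $\mu_{\rm t}(K_n\times K_m)=\mu(K_n\times K_m)=nm-4$.
   Context: $K_n\times K_m$ is the direct product of complete graphs: vertex set $[n]\times[m]$, with $(i,j)$ adjacent to $(i',j')$ iff $i\ne i'$ and $j\ne j'$. For a connected graph $G$ and $X\subseteq V(G)$, two vertices $x,y$ are $X$-visible if there is a shortest $x,y$-path whose internal vertices are not in $X$. $X$ is a mutual-visibility set if every two vertices of $X$ are $X$-visible, and a total mutual-visibility set if every two vertices of $V(G)$ are $X$-visible. $\mu(G)$ and $\mu_{\rm t}(G)$ denote the maximum cardinality of a mutual-visibility set, respectively total mutual-visibility set, of $G$. *)

(* Defs.v *)
From mathcomp Require Import all_boot.
From mathcomp Require Import boolp.

Set Implicit Arguments.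
Unset Strict Implicit.
Unset Printing Implicit Defensive.

(* A finite simple graph is given by its adjacency relation, a symmetric and
   irreflexive [e : rel T] on a finite type [T]. *)

Definition complete_graph (T : finType) : rel T := [rel x y | x != y].
Arguments complete_graph T : clear implicits.

Definition direct_product (T U : finType) (e : rel T) (f : rel U) :
  rel (T * U)%type := [rel a b | e a.1 b.1 && f a.2 b.2].

Section MutualVisibility.
Variables (T : finType) (e : rel T).
Implicit Types (x y : T) (p q : seq T) (X : {set T}).

(* The walk [x :: p] from [x] to [y] has length [size p].  A walk of minimum
   length never repeats a vertex, so shortest paths are shortest walks. *)
Definition walk x y p : Prop := path e x p /\ last x p = y.

Definition shortest_path x y p : Prop :=
  walk x y p /\ forall q, walk x y q -> size p <= size q.

(* [x :: p] without its first and last vertex. *)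
Definition internal x p : seq T := behead (belast x p).

Definition visible X x y : Prop :=
  exists p, shortest_path x y p /\ forall z, z \in internal x p -> z \notin X.

Definition mutual_visibility_set X : Prop :=
  forall x y, x \in X -> y \in X -> x != y -> visible X x y.

Definition total_mutual_visibility_set X : Prop :=
  forall x y, x != y -> visible X x y.

(* In a connected graph the empty set satisfies both predicates, so neither
   maximum is taken over an empty range. *)
Definition mu : nat := \max_(X : {set T} | `[< mutual_visibility_set X >]) #|X|.

Definition mu_t : nat :=
  \max_(X : {set T} | `[< total_mutual_visibility_set X >]) #|X|.

End MutualVisibility.

(* Main.v *)
(** Let [Y] be the complement of [X].  Distinct nonadjacent vertices of
    [K_n x K_m] share a row or a column and have a common neighbour, so they
    are [X]-visible iff some common neighbour lies in [Y].

    If [Y] consists of four vertices with distinct rows and distinct columns,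
    two nonadjacent vertices involve at most three lines in total, each
    meeting [Y] at most once, so a vertex of [Y] is adjacent to both.

    Conversely, let [Y] have at most three vertices.  If they lie in two
    columns, the two vertices in which a row missing [Y] meets these columns
    have no common neighbour in [Y]; symmetrically for two rows.  Otherwise
    [Y] has three vertices with distinct rows and columns, and the row of the
    first crossed with the columns of the other two gives such a pair. *)
Require Import Defs.
From mathcomp Require Import all_boot.
From mathcomp Require Import boolp zify.

Set Implicit Arguments.
Unset Strict Implicit.
Unset Printing Implicit Defensive.

Lemma exists_notin_seq (T : eqType) (s t : seq T) :
  uniq s -> size t < size s -> exists2 x, x \in s & x \notin t.
Proof.
move=> us lt_ts; apply/hasP; rewrite has_predC; apply: contraL lt_ts.
by move=> /allP sub; rewrite -leqNgt; apply: uniq_leq_size.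
Qed.

Lemma exists_notin_seq_fin (T : finType) (t : seq T) :
  size t < #|T| -> exists x, x \notin t.
Proof.
rewrite cardE => lt_t.
by have [x _ xt] := exists_notin_seq (enum_uniq T) lt_t; exists x.
Qed.

(** Removing duplicates leaves one or two values; if only one is left, [1 < #|T|] supplies a second.
    Applied to the rows or columns of three vertices, it confines them to two lines. *)
Lemma not_uniq3_sub_pair (T : finType) (a b c : T) :
    1 < #|T| -> ~~ uniq [:: a; b; c] ->
  exists j k, j != k /\ {subset [:: a; b; c] <= [:: j; k]}.
Proof.
move=> cT nuniq.
have lt_undup : size (undup [:: a; b; c]) <= 2.
  by rewrite -ltnS ltn_size_undup.
have sub x : x \in [:: a; b; c] -> x \in undup [:: a; b; c].
  by rewrite mem_undup.
have := undup_uniq [:: a; b; c].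
case: (undup _) lt_undup sub => [|j [|k [|//]]] _ sub.
- by have := sub a; rewrite mem_head => /(_ isT).
- have [k] := @exists_notin_seq_fin _ [:: j] cT; rewrite inE => kj _.
  exists j, k; split; first by rewrite eq_sym.
  by move=> x /sub; rewrite !inE => ->.
- by rewrite /= andbT inE => jk; exists j, k.
Qed.

Section Visibility.
Variables (T : finType) (e : rel T).
Implicit Types (x y z : T) (X : {set T}).

Lemma visible_adjacent X x y : x != y -> e x y -> visible e X x y.
Proof.
move=> neq exy; exists [:: y]; split=> //; split.
  by split=> //=; rewrite exy.
by case=> [|? ?] [_ //= eq_xy]; rewrite eq_xy eqxx in neq.
Qed.

Lemma visible_common_neighbour X x y z :
    x != y -> ~~ e x y -> e x z -> e z y -> z \notin X ->
  visible e X x y.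
Proof.
move=> neq nexy exz ezy zX; exists [:: z; y]; split; last first.
  by move=> w; rewrite /internal /= inE => /eqP->.
split; first by split=> //=; rewrite exz ezy.
case=> [|a [|b q]] [//=].
- by move=> _ eq_xy; rewrite eq_xy eqxx in neq.
- by rewrite andbT => exa eq_ay; rewrite -eq_ay exa in nexy.
Qed.

(** The vertex [z], possibly in [X], only bounds the distance by 2. A shortest path then has exactly
    one internal vertex, and that one avoids [X]. *)
Lemma common_neighbour_of_visible X x y z :
    x != y -> ~~ e x y -> e x z -> e z y -> visible e X x y ->
  exists w, [/\ e x w, e w y & w \notin X].
Proof.
move=> neq nexy exz ezy [p [[[pathp lastp] minp] intp]].
have {minp} : size p <= 2.
  by apply: (minp [:: z; y]); split=> //=; rewrite exz ezy.
case: p pathp lastp intp => [|a [|b [|//]]] /=.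
- by move=> _ eq_xy; rewrite eq_xy eqxx in neq.
- by rewrite andbT => exa eq_ay; rewrite -eq_ay exa in nexy.
- case/and3P=> exa eab _ eq_by intp _; exists a; split=> //.
    by rewrite -eq_by.
  by apply: intp; rewrite /internal /= inE.
Qed.

Lemma total_mutual_visibility_set_mutual X :
  total_mutual_visibility_set e X -> mutual_visibility_set e X.
Proof. by move=> tX x y _ _; apply: tX. Qed.

Lemma mu_t_le_mu : mu_t e <= mu e.
Proof.
apply/bigmax_leqP=> X /asboolP tX; apply: leq_bigmax_cond; apply/asboolP.
exact: total_mutual_visibility_set_mutual.
Qed.

End Visibility.

Section CompleteProduct.
Variables (A B : finType).
Let G := direct_product (complete_graph A) (complete_graph B).
Implicit Types (x y z : A * B).

Lemma complete_productE x y : G x y = (x.1 != y.1) && (x.2 != y.2).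
Proof. by []. Qed.

Lemma complete_product_common_neighbour x y :
  2 < #|A| -> 2 < #|B| -> exists z, G x z && G z y.
Proof.
move=> cA cB.
have [a] := @exists_notin_seq_fin _ [:: x.1; y.1] cA.
have [b] := @exists_notin_seq_fin _ [:: x.2; y.2] cB.
rewrite !inE !negb_or => /andP[bx by_] /andP[ax ay].
exists (a, b); rewrite !complete_productE /=.
by rewrite [x.1 == _]eq_sym [x.2 == _]eq_sym ax ay bx by_.
Qed.

(** Here [s] is a list covering the complement of [X]. Asking [x] and [y] to avoid [s] puts them in
    [X], so the pair refutes mutual visibility and not just total mutual visibility. *)
Definition blocked_pair (s : seq (A * B)) x y :=
  [/\ x != y, ~~ G x y, x \notin s, y \notin s &
      {in s, forall z, ~~ (G x z && G z y)}].

Lemma blocked_pair_two_columns (s : seq (A * B)) (j k : B) :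
    size s < #|A| -> j != k -> {in s, forall z, z.2 \in [:: j; k]} ->
  exists x y, blocked_pair s x y.
Proof.
move=> cA neq cols.
have [|i is_] := @exists_notin_seq_fin A (map fst s); first by rewrite size_map.
have notin b : (i, b) \notin s.
  by apply: contra is_ => ibs; apply/mapP; exists (i, b).
exists (i, j), (i, k); split=> //.
- by rewrite xpair_eqE eqxx.
- by rewrite complete_productE eqxx.
- move=> z /cols; rewrite !inE !complete_productE /=.
  by case/orP=> /eqP->; rewrite eqxx ?andbF.
Qed.

Lemma blocked_pair_two_rows (s : seq (A * B)) (i k : A) :
    size s < #|B| -> i != k -> {in s, forall z, z.1 \in [:: i; k]} ->
  exists x y, blocked_pair s x y.
Proof.
move=> cB neq rows.
have [|j js] := @exists_notin_seq_fin B (map snd s); first by rewrite size_map.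
have notin a : (a, j) \notin s.
  by apply: contra js => ajs; apply/mapP; exists (a, j).
exists (i, j), (k, j); split=> //.
- by rewrite xpair_eqE eqxx andbT.
- by rewrite complete_productE eqxx andbF.
- move=> z /rows; rewrite !inE !complete_productE /=.
  by case/orP=> /eqP->; rewrite eqxx ?andbF.
Qed.

Lemma exists_blocked_pair y1 y2 y3 :
  3 < #|A| -> 3 < #|B| -> exists x y, blocked_pair [:: y1; y2; y3] x y.
Proof.
move=> cA cB.
have [ucols|/not_uniq3_sub_pair] := boolP (uniq (map snd [:: y1; y2; y3])).
  have [urows|/not_uniq3_sub_pair] := boolP (uniq (map fst [:: y1; y2; y3])).
    case: y1 y2 y3 ucols urows => [r1 c1] [r2 c2] [r3 c3] /=.
    rewrite !inE !negb_or !andbT => /andP[/andP[c12 c13] c23].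
    case/andP=> /andP[r12 r13] r23.
    (* The first vertex of the list shares row [r1] with both witnesses; the second and third each
       share a column with one of them. *)
    exists (r1, c2), (r1, c3); split.
    - by rewrite xpair_eqE eqxx.
    - by rewrite complete_productE eqxx.
    - rewrite !inE !xpair_eqE [c2 == c1]eq_sym !negb_or !negb_and.
      by rewrite c12 r12 r13 orbT.
    - rewrite !inE !xpair_eqE [c3 == c1]eq_sym !negb_or !negb_and.
      by rewrite c13 r12 r13 orbT.
    - move=> z; rewrite !inE !complete_productE => /or3P[] /eqP-> /=;
      by rewrite eqxx ?andbF.
  case; first exact: ltn_trans cA.
  move=> i [k [neq sub]]; apply: blocked_pair_two_rows neq _ => // z zs.
  by apply: sub; apply: (map_f fst zs).
case; first exact: ltn_trans cB.
move=> i [k [neq sub]]; apply: blocked_pair_two_columns neq _ => // z zs.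
by apply: sub; apply: (map_f snd zs).
Qed.

Lemma mutual_visibility_set_card (X : {set A * B}) :
    3 < #|A| -> 3 < #|B| -> mutual_visibility_set G X ->
  #|X| <= #|A| * #|B| - 4.
Proof.
move=> cA cB mX; have := cardsC X; rewrite card_prod => cX.
suff : 3 < #|~: X| by lia.
rewrite ltnNge; apply/negP=> cY.
have [a _] := @exists_notin_seq_fin A [::] (leq_ltn_trans (leq0n _) cA).
have [b _] := @exists_notin_seq_fin B [::] (leq_ltn_trans (leq0n _) cB).
(* The complement is padded with [(a, b)] to exactly three entries. The padding may lie in [X],
   which is harmless: [s] only has to contain the complement. *)
pose s := [seq nth (a, b) (enum (~: X)) i | i <- iota 0 3].
have Xs z : z \notin s -> z \in X.
  apply: contraR => zX; have zY : z \in enum (~: X) by rewrite mem_enum inE.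
  apply/mapP; exists (index z (enum (~: X))); last by rewrite nth_index.
  by rewrite mem_iota /=; apply: leq_trans cY; rewrite cardE index_mem.
have [x [y [neq nxy xs ys noz]]] : exists x y, blocked_pair s x y.
  exact: exists_blocked_pair.
have [z /andP[xz zy]] : exists z, G x z && G z y.
  by apply: complete_product_common_neighbour; apply: ltn_trans (ltnSn 2) _.
have := mX _ _ (Xs _ xs) (Xs _ ys) neq.
case/(common_neighbour_of_visible neq nxy xz zy)=> w [xw wy wX].
have ws : w \in s by apply: contraR wX; apply: Xs.
by have := noz _ ws; rewrite xw wy.
Qed.

End CompleteProduct.

Section Diagonal.
Variables (n m : nat) (hn : 4 <= n) (hm : 4 <= m).
Let G := direct_product (complete_graph 'I_n) (complete_graph 'I_m).

Definition diagonal4 : {set 'I_n * 'I_m} :=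
  [set (widen_ord hn k, widen_ord hm k) | k : 'I_4].

Lemma card_diagonal4 : #|diagonal4| = 4.
Proof.
rewrite card_imset ?card_ord // => j k [eq_jk _].
exact: val_inj.
Qed.

Lemma diagonal4_complement_total :
  total_mutual_visibility_set G (~: diagonal4).
Proof.
move=> x y neq; have [xy|nxy] := boolP (G x y); first exact: visible_adjacent.
(* A nonadjacent pair shares a coordinate, so three indices list all its rows and columns; in the
   second branch [x.2] also stands for [y.2]. One of the four diagonal indices escapes them. *)
pose t : seq nat := if x.1 == y.1 then [:: val x.1; val x.2; val y.2]
                    else [:: val x.1; val y.1; val x.2].
have [||k] := @exists_notin_seq _ (iota 0 4) t.
- exact: iota_uniq.
- by rewrite /t; case: ifP.
rewrite mem_iota /= add0n => k4 kt.
pose z := (widen_ord hn (Ordinal k4), widen_ord hm (Ordinal k4)).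
have /and4P[x1 x2 y1 y2] : [&& val x.1 != k, val x.2 != k, k != y.1 & k != y.2].
  move: nxy kt; rewrite /G complete_productE negb_and !negbK /t.
  case: eqP => [-> _|_ /= /eqP->];
  rewrite !inE !negb_or => /and3P[]; rewrite ![k == _]eq_sym.
    by move=> -> -> ->.
  by move=> -> -> ->.
apply: (@visible_common_neighbour _ _ _ _ _ z) => //.
- by rewrite /G complete_productE -!val_eqE /= x1 x2.
- by rewrite /G complete_productE -!val_eqE /= y1 y2.
- by rewrite inE negbK; apply/imsetP; exists (Ordinal k4).
Qed.

End Diagonal.

Theorem theorem2p2 (n m : nat) (hn : 5 <= n) (hm : 5 <= m) :
  let G := direct_product (complete_graph 'I_n) (complete_graph 'I_m) in
  mu_t G = mu G /\ mu G = n * m - 4.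
Proof.
move=> G; have hn4 := ltnW hn; have hm4 := ltnW hm.
have mu_le : mu G <= n * m - 4.
  apply/bigmax_leqP=> X /asboolP mX.
  by have := mutual_visibility_set_card _ _ mX; rewrite !card_ord; apply.
have le_mu_t : n * m - 4 <= mu_t G.
  have := cardsC (diagonal4 hn4 hm4).
  rewrite card_diagonal4 card_prod !card_ord => <-; rewrite addKn.
  apply: leq_bigmax_cond; apply/asboolP.
  exact: diagonal4_complement_total.
(* This closes the cycle of inequalities [n * m - 4 <= mu_t G <= mu G <= n * m - 4]. *)
have := mu_t_le_mu G; lia.
Qed.
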